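(* Let $T\in(0,\infty)$, let $x_0>0$ be a constant, and let the process $X=\{X_t\}_{t\in[0,T]}$ be given by the strong solution of the stochastic differential equation $$dX_t=\mu_t\,dt+\sigma_t\,dW_t,\qquad X_0=x_0,$$ where $W$ is a (possibly multidimensional) Brownian motion and $\mu,\sigma$ are progressively measurable functionals such that the strong solution exists and is unique on $[0,T]$. Let $N$ and $K$ be positive integers, and let $X^1,\dots,X^N$ be $N$ realizations (Monte Carlo simulations) of the process $X$, all started at $X^n_0=x_0$. Let $f_1,\dots,f_K$ be continuous functions such that $\sum_{k=1}^K f_k^2(X_0)>0$. For each $t\in[0,T]$ let $A(t)$ be the $N\times K$ matrix with entries $$A(t)_{n,k}=f_k\left(X^n_t\right),\qquad 1\le n\le N,\ 1\le k\le K,$$ and let $\kappa(t)$ be the condition number of $A(t)$. Then $$\mathbb{P}\left[\lim_{t\to 0^+}\kappa(t)=\infty\right]=1.$$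
   Context: The Brownian motion $W$ is defined on a filtered probability space $(\Omega,\mathcal{F},\{\mathcal{F}_t\}_{t\in[0,T]},\mathbb{P})$, where $\mathbb{P}$ is the risk-neutral probability measure. $X$ models a real-valued stock price. The realizations $X^1,\dots,X^N$ are copies of $X$ (one per simulation), regarded as processes on a common probability space whose measure is again denoted $\mathbb{P}$; each has almost surely continuous paths. The matrix $A(t)$ is the matrix of the linear regression (least squares) problem onto the basis functions $f_1,\dots,f_K$ in the Least Squares Monte Carlo algorithm for pricing American options. The number $K$ of basis functions is arbitrary. The condition number of a matrix $A$ in the $l_2$ norm is $\kappa(A)=\|A\|\cdot\|A^{-1}\|=\sigma_{\max}(A)/\sigma_{\min}(A)$, where $\sigma_{\max}(A)$ and $\sigma_{\min}(A)$ are the maximal and minimal singular values of $A$. Here the singular values of the $N\times K$ matrix $A$ are the square roots of the $K$ eigenvalues (counted with multiplicity) of $A^TA$, and $\kappa(A)=\infty$ when $\sigma_{\min}(A)=0$.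
   Formalization: The number K of basis functions is assumed to be at least 2; for K = 1 the claim is false, since A(t) is then a single column, nonzero for small t almost surely, so its condition number equals 1 near t = 0. *)

(* Defs.v *)
From HB Require Import structures.
From mathcomp Require Import all_boot all_order all_algebra.
From mathcomp Require Import all_classical all_reals all_analysis.

Set Implicit Arguments.
Unset Strict Implicit.
Unset Printing Implicit Defensive.

Import Order.TTheory GRing.Theory Num.Theory.
Import numFieldNormedType.Exports.

Local Open Scope classical_set_scope.
Local Open Scope ring_scope.

Section condition_number.
Context {R : realType} {N K : nat}.

Definition singular_values (A : 'M[R]_(N, K)) : set R :=
  [set Num.sqrt a | a in [set a | eigenvalue (A^T *m A) a]].

(* For 0 < K the set of singular values is finite and nonempty, so [sup] and
   [inf] are a maximum and a minimum; multiplicities do not affect them. *)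
Definition sigma_max (A : 'M[R]_(N, K)) : R := sup (singular_values A).

Definition sigma_min (A : 'M[R]_(N, K)) : R := inf (singular_values A).

Definition cond_number (A : 'M[R]_(N, K)) : \bar R :=
  if sigma_min A == 0 then +oo%E else (sigma_max A / sigma_min A)%:E.

End condition_number.

(* A process is a function [R -> Omega -> R] of which only the times in [0, T]
   are ever used. *)
Section processes.
Context {R : realType} {d : measure_display} {Omega : measurableType d}.
Variables (P : probability Omega R) (T : R).
Implicit Types (F : R -> set (set Omega)) (X W : R -> Omega -> R).

Definition is_filtration F : Prop :=
  [/\ forall t, t \in `[0, T] -> sigma_algebra setT (F t),
      forall t, t \in `[0, T] -> F t `<=` measurable &
      forall s t, 0 <= s -> s <= t -> t <= T -> F s `<=` F t].

Definition measurable_wrt (G : set (set Omega)) (g : Omega -> R) : Prop :=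
  forall B : set R, measurable B -> G (g @^-1` B).

Definition adapted F X : Prop :=
  forall t, t \in `[0, T] -> measurable_wrt (F t) (X t).

Definition as_continuous_paths X : Prop :=
  {ae P, forall w, {within `[0, T], continuous (X ^~ w)}}.

(* m-dimensional standard F-Brownian motion.  The product rule says at once
   that W t - W s is independent of F s and has law N(0, (t - s) Id). *)
Definition is_brownian_motion F (m : nat) (W : 'I_m -> R -> Omega -> R) :
    Prop :=
  [/\ forall i, adapted F (W i),
      forall i, as_continuous_paths (W i),
      forall i, {ae P, forall w, W i 0 w = 0} &
      forall s t, 0 <= s -> s < t -> t <= T ->
      forall (A : set Omega) (B : 'I_m -> set R), F s A ->
        (forall i, measurable (B i)) ->
        P (A `&` [set w | forall i, B i (W i t w - W i s w)]) =
        (P A * \prod_(i < m) normal_prob 0 (Num.sqrt (t - s)) (B i))%E].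

(* Random, path-dependent coefficients [a t w x], where x is a path.
   [a] is progressively measurable if its restriction to
   [0, t] * Omega * C([0, T]) is B([0, t]) (x) F_t (x) C_t - measurable for
   every t <= T, C_t being generated by the evaluations x |-> x r, r <= t.
   The values of [a] at discontinuous paths are irrelevant. *)
Definition path_space : set (R -> R) :=
  [set x | {within `[0, T], continuous x}].

Definition progressive_domain (t : R) : set (R * Omega * (R -> R)) :=
  [set u | u.1.1 \in `[0, t] /\ path_space u.2].

Definition progressive_generators F (t : R) :
    set (set (R * Omega * (R -> R))) :=
  [set progressive_domain t `&` [set u | B u.1.1]
     | B in (measurable : set (set R))] `|`
  [set progressive_domain t `&` [set u | A u.1.2] | A in F t] `|`
  [set C | exists (r : R) (B : set R), [/\ r \in `[0, t], measurable B &
     C = progressive_domain t `&` [set u | B (u.2 r)]]].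

Definition progressive_functional F (a : R -> Omega -> (R -> R) -> R) : Prop :=
  forall t, t \in `[0, T] -> forall B : set R, measurable B ->
    <<s progressive_domain t, progressive_generators F t >>
      (progressive_domain t `&` [set u | B (a u.1.1 u.1.2 u.2)]).

Record simple_process F := SimpleProcess {
  sp_size : nat;
  sp_time : nat -> R;
  sp_coef : nat -> Omega -> R;
  sp_time_first : sp_time 0%N = 0;
  sp_time_last : sp_time sp_size = T;
  sp_time_nd : forall j, (j < sp_size)%N -> sp_time j <= sp_time j.+1;
  sp_coef_meas : forall j, (j < sp_size)%N ->
    measurable_wrt (F (sp_time j)) (sp_coef j);
  sp_coef_bounded : exists M : R, forall j w, (j < sp_size)%N ->
    `|sp_coef j w| <= M }.

Definition simple_value F (H : simple_process F) (s : R) (w : Omega) : R :=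
  \sum_(j < sp_size H)
    sp_coef H j w * \1_(`]sp_time H j, sp_time H j.+1] : set R) s.

Definition simple_integral F (H : simple_process F) W (t : R) (w : Omega) : R :=
  \sum_(j < sp_size H) sp_coef H j w *
    (W (Num.min t (sp_time H j.+1)) w - W (Num.min t (sp_time H j)) w).

(* Convergence to 0 in probability of nonnegative functions, through measurable
   covers of the events [eps <= Y n] since these are only measurable up to null
   sets when paths are continuous almost surely. *)
Definition cvg_probability0 (Y : nat -> Omega -> \bar R) : Prop :=
  forall eps : R, 0 < eps -> exists E : nat -> set Omega,
    [/\ forall n, measurable (E n),
        forall n, [set w | (eps%:E <= Y n w)%E] `<=` E n &
        P (E n) @[n --> \oo] --> 0%E].

(* [I] is (a version of) the process t |-> \int_0^t a_s dW_s: the limit,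
   uniformly on [0, T] in probability, of the integrals of simple processes
   approximating [a] in L^2([0, T]) in probability. *)
Definition is_ito_integral F W (a I : R -> Omega -> R) : Prop :=
  exists H : nat -> simple_process F,
    cvg_probability0 (fun n w =>
      (\int[lebesgue_measure]_(s in `[0%R, T])
        ((simple_value (H n) s w - a s w) ^+ 2)%:E)%E) /\
    cvg_probability0 (fun n w =>
      ereal_sup [set `|simple_integral (H n) W t w - I t w|%:E
                | t in [set` `[0, T]]]).

(* X is a solution, on the given stochastic basis and for the given Brownian
   motion, of dX_t = mu_t(X) dt + \sum_i sigma^i_t(X) dW^i_t, X_0 = x0. *)
Definition is_strong_solution F (m : nat) (W : 'I_m -> R -> Omega -> R)
    (mu : R -> Omega -> (R -> R) -> R)
    (sigma : 'I_m -> R -> Omega -> (R -> R) -> R) (x0 : R) X : Prop :=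
  [/\ adapted F X /\ as_continuous_paths X,
      {ae P, forall w, X 0 w = x0},
      {ae P, forall w, lebesgue_measure.-integrable `[0, T]
                         (fun s => (mu s w (X ^~ w))%:E)},
      forall i, {ae P, forall w, lebesgue_measure.-integrable `[0, T]
                         (fun s => ((sigma i s w (X ^~ w)) ^+ 2)%:E)} &
      exists I : 'I_m -> R -> Omega -> R,
        (forall i, is_ito_integral F (W i)
                     (fun s w => sigma i s w (X ^~ w)) (I i)) /\
        {ae P, forall w, forall t, t \in `[0, T] ->
           X t w = x0 + \int[lebesgue_measure]_(s in `[0, t]) mu s w (X ^~ w)
                   + \sum_(i < m) I i t w}].

Definition is_unique_strong_solution F (m : nat)
    (W : 'I_m -> R -> Omega -> R) (mu : R -> Omega -> (R -> R) -> R)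
    (sigma : 'I_m -> R -> Omega -> (R -> R) -> R) (x0 : R) X : Prop :=
  is_strong_solution F W mu sigma x0 X /\
  forall Y, is_strong_solution F W mu sigma x0 Y ->
    {ae P, forall w, forall t, t \in `[0, T] -> Y t w = X t w}.

End processes.

(* Y, possibly on another probability space, is a copy of X: it has the same
   finite-dimensional distributions and almost surely continuous paths. *)
Definition is_copy {R : realType} {d d' : measure_display}
    {Omega : measurableType d} {Omega' : measurableType d'}
    (P : probability Omega R) (Q : probability Omega' R) (T : R)
    (X : R -> Omega -> R) (Y : R -> Omega' -> R) : Prop :=
  [/\ forall t, t \in `[0, T] -> measurable_fun setT (Y t),
      forall (m : nat) (t : 'I_m -> R) (B : 'I_m -> set R),
        (forall i, t i \in `[0, T]) -> (forall i, measurable (B i)) ->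
        Q [set w | forall i, B i (Y (t i) w)] =
        P [set w | forall i, B i (X (t i) w)] &
      as_continuous_paths Q T Y].

Definition regression_matrix {R : realType} {S : Type} {N K : nat}
    (f : 'I_K -> R -> R) (X : 'I_N -> R -> S -> R) (t : R) (w : S) :
    'M[R]_(N, K) :=
  \matrix_(n < N, k < K) f k (X n t w).

(* Main.v *)
Require Import Defs.
From mathcomp Require Import all_boot all_order all_algebra.
From mathcomp Require Import all_classical all_reals all_analysis.
From mathcomp Require Import complex.
Import Order.TTheory GRing.Theory Num.Theory.
Import numFieldNormedType.Exports.
Local Open Scope classical_set_scope.
Local Open Scope ring_scope.

(* Almost surely all N paths are continuous and start at x0, so A(t) converges
   entrywise to A(0), whose rows all equal (f_1(x0), ..., f_K(x0)): a nonzero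
   matrix of rank 1 < K.  Hence det(A(t)^T A(t)), the product of the squared
   singular values, tends to 0, while the trace of A(t)^T A(t), their sum, tends
   to a positive limit: the smallest singular value tends to 0 and the largest
   one stays bounded away from 0. *)

(** Over the complex numbers [A] becomes Hermitian, hence diagonalizable with a real diagonal, whose
    entries are the [r i]. Allowing every shift [a] lets one family [r] give the eigenvalues, the
    determinant (at [a = 0]) and the trace. *)
Lemma symmetric_real_spectrum (R : rcfType) (n : nat) (A : 'M[R]_n) :
  A^T = A -> exists r : 'I_n -> R,
    (forall a, \det (A - a%:M) = \prod_i (r i - a)) /\ \tr A = \sum_i r i.
Proof.
move=> symA; pose C := map_mx (real_complex R) A.
have Chermi : C \is hermsymmx.
  apply: realsym_hermsym.
    by apply/is_hermitianmxP; rewrite expr0 scale1r map_mx_id // map_trmx symA.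
  by apply/mxOverP => i j; rewrite mxE complex_real.
have [P uP [D Dreal defC]] : exists2 P, P \in unitmx &
    exists2 D, D \is a mxOver Num.real & C = invmx P *m diag_mx D *m P.
  exists (spectralmx C); first exact: spectral_unit.
  exists (spectral_diag C); first exact: hermitian_spectral_diag_real.
  exact/orthomx_spectralP/hermitian_normalmx.
have defD i : D 0 i = real_complex R (complex.Re (D 0 i)).
  by rewrite /= RRe_real //; exact: (mxOverP Dreal).
exists (fun i => complex.Re (D 0 i)); split=> [a|].
  apply: (fmorph_inj (real_complex R)).
  rewrite -det_map_mx map_mxB map_scalar_mx -/C defC.
  (* Conjugation fixes scalar matrices, so the shifted matrix is conjugate to the shifted
     diagonal. *)
  have -> : (real_complex R a)%:M = invmx P *m (real_complex R a)%:M *m P.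
    by rewrite mul_mx_scalar -scalemxAl mulVmx // scalemx1.
  rewrite -mulmxBl -mulmxBr !det_mulmx mulrAC -det_mulmx mulVmx // det1 mul1r.
  have -> : diag_mx D - (real_complex R a)%:M
      = diag_mx (\row_i (D 0 i - real_complex R a)).
    by apply/matrixP => i j; rewrite !mxE -mulrnBl.
  rewrite det_diag rmorph_prod; apply: eq_bigr => i _.
  by rewrite mxE [in LHS]defD rmorphB.
apply: (fmorph_inj (real_complex R)).
rewrite -trace_map_mx -/C defC mxtrace_mulC mulmxA mulmxV // mul1mx.
by rewrite mxtrace_diag rmorph_sum; apply: eq_bigr => i _; exact: defD.
Qed.

Lemma eigenvalue_det (F : fieldType) (n : nat) (A : 'M[F]_n) (a : F) :
  eigenvalue A a = (\det (A - a%:M) == 0).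
Proof.
by rewrite /eigenvalue /eigenspace kermx_eq0 row_free_unit unitmxE unitfE negbK.
Qed.

(* The trace forces an eigenvalue above [b], the determinant one below
   [b / M ^+ 2]. *)
Lemma cond_number_ge (R : realType) (N K : nat) (A : 'M[R]_(N, K)) (M b : R) :
  0 < M -> 0 < b -> b *+ K < \tr (A^T *m A) ->
  \det (A^T *m A) < (b / M ^+ 2) ^+ K -> (M%:E <= cond_number A)%E.
Proof.
move=> M0 b0 trA detA.
have /symmetric_real_spectrum[r [detr trr]] : (A^T *m A)^T = A^T *m A.
  by rewrite trmx_mul trmxK.
have eigP a : eigenvalue (A^T *m A) a <-> exists i, a = r i.
  rewrite eigenvalue_det detr; split.
    by move=> /prodf_eq0[i _]; rewrite subr_eq0 => /eqP <-; exists i.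
  by move=> [i ->]; apply/prodf_eq0; exists i => //; rewrite subrr.
have inS i : singular_values A (Num.sqrt (r i)).
  by exists (r i) => //=; apply/eigP; exists i.
have SP x : singular_values A x -> exists i, x = Num.sqrt (r i).
  by move=> [a /= /eigP[i ->] <-]; exists i.
have [i bi] : exists i, b < r i.
  apply/existsP; apply: contraTT trA => /existsPn rb.
  rewrite -leNgt trr -[X in b *+ X]card_ord -sumr_const.
  by apply: ler_sum => i _; rewrite leNgt rb.
have [j rj] : exists j, r j < b / M ^+ 2.
  apply/existsP; apply: contraTT detA => /existsPn rb.
  have := detr 0; rewrite raddf0 subr0 => ->.
  rewrite -leNgt -[X in _ ^+ X]card_ord -prodr_const.
  apply: ler_prod => k _; rewrite subr0 divr_ge0 ?exprn_ge0 ?(ltW b0) ?(ltW M0) //=.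
  by rewrite leNgt rb.
have lb0 : lbound (singular_values A) 0.
  by move=> x /SP[k ->]; exact: sqrtr_ge0.
have smax : Num.sqrt b <= sigma_max A.
  apply: (le_trans (ler_wsqrtr (ltW bi))); apply: ub_le_sup (inS i).
  (* [sup] needs a bounded set: the sum of the nonnegative roots dominates each of them. *)
  exists (\sum_k Num.sqrt (r k)) => x /SP[k ->].
  by rewrite (bigD1 k) //= lerDl sumr_ge0 // => l _; exact: sqrtr_ge0.
(* The thresholds [b] and [b / M ^+ 2] are chosen so that their square roots have ratio [M]. *)
have smin : sigma_min A <= Num.sqrt b / M.
  have -> : Num.sqrt b / M = Num.sqrt (b / M ^+ 2).
    by rewrite sqrtrM ?(ltW b0) // sqrtrV ?exprn_ge0 ?(ltW M0) // sqrtr_sqr gtr0_norm.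
  apply: (le_trans _ (ler_wsqrtr (ltW rj))).
  by apply: ge_inf (inS j); exists 0.
have smin0 : 0 <= sigma_min A.
  by apply: lb_le_inf => //; exists (Num.sqrt (r j)).
rewrite /cond_number; case: eqVneq => [_|sminN0]; first by rewrite leey.
rewrite lee_fin ler_pdivlMr; last by rewrite lt_def sminN0.
by apply: le_trans smax; rewrite mulrC -ler_pdivlMr.
Qed.

Lemma cvg_bigsum (R : realType) (T I : Type) (F : set_system T) (FF : Filter F)
    (r : seq I) (g : I -> T -> R) (l : I -> R) :
  (forall i, g i x @[x --> F] --> l i) ->
  \sum_(i <- r) g i x @[x --> F] --> \sum_(i <- r) l i.
Proof. by move=> gl; apply: cvg_big => //; exact: add_continuous. Qed.

Lemma cvg_bigprod (R : realType) (T I : Type) (F : set_system T) (FF : Filter F)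
    (r : seq I) (g : I -> T -> R) (l : I -> R) :
  (forall i, g i x @[x --> F] --> l i) ->
  \prod_(i <- r) g i x @[x --> F] --> \prod_(i <- r) l i.
Proof. by move=> gl; apply: cvg_big => //; exact: mul_continuous. Qed.

Section entrywise_limits.
Context {R : realType} {T : Type} {F : set_system T} {FF : Filter F}.

Lemma cvg_mxtrace (n : nat) (A : T -> 'M[R]_n) (L : 'M[R]_n) :
  (forall i j, A x i j @[x --> F] --> L i j) -> \tr (A x) @[x --> F] --> \tr L.
Proof. by move=> AL; apply: cvg_bigsum. Qed.

Lemma cvg_det (n : nat) (A : T -> 'M[R]_n) (L : 'M[R]_n) :
  (forall i j, A x i j @[x --> F] --> L i j) ->
  \det (A x) @[x --> F] --> \det L.
Proof.
(* Leibniz formula: a sum over permutations of signed products of entries. *)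
move=> AL; apply: cvg_bigsum => s.
by apply: cvgM; [exact: cvg_cst | exact: cvg_bigprod].
Qed.

Lemma cvg_gram (m n : nat) (A : T -> 'M[R]_(m, n)) (L : 'M[R]_(m, n)) :
  (forall i j, A x i j @[x --> F] --> L i j) ->
  forall i j, ((A x)^T *m A x) i j @[x --> F] --> (L^T *m L) i j.
Proof.
move=> AL i j; rewrite mxE; under eq_fun do rewrite mxE.
by apply: cvg_bigsum => k; rewrite mxE; under eq_fun do rewrite mxE; exact: cvgM.
Qed.

Lemma mxtrace_gram (m n : nat) (A : 'M[R]_(m, n)) :
  \tr (A^T *m A) = \sum_j \sum_i A i j ^+ 2.
Proof.
apply: eq_bigr => j _; rewrite mxE; apply: eq_bigr => i _.
by rewrite mxE expr2.
Qed.

(** Rank deficiency of [L] sends the Gram determinant to 0 and [L != 0] keeps the limit of the trace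
    positive, so [cond_number_ge] eventually applies for every bound [M]. *)
Lemma cvg_cond_number_pinfty (m n : nat) (A : T -> 'M[R]_(m, n))
    (L : 'M[R]_(m, n)) :
  (forall i j, A x i j @[x --> F] --> L i j) -> L != 0 -> (\rank L < n)%N ->
  cond_number (A x) @[x --> F] --> +oo%E.
Proof.
move=> AL L0 rkL.
have n0 : (0 < n)%N by exact: leq_ltn_trans rkL.
have trL : 0 < \tr (L^T *m L).
  have sq_ge0 j : 0 <= \sum_i L i j ^+ 2 by apply: sumr_ge0 => i _; exact: sqr_ge0.
  rewrite mxtrace_gram lt_def sumr_ge0 // andbT.
  (* A vanishing sum of squares forces every entry of [L] to be 0. *)
  apply: contra L0 => /eqP/psumr_eq0P-/(_ (fun j _ => sq_ge0 j)) L0.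
  apply/eqP/matrixP => i j; rewrite mxE; apply/eqP; rewrite -sqrf_eq0; apply/eqP.
  by apply: (psumr_eq0P _ (L0 j isT)) => // k _; exact: sqr_ge0.
have detL : \det (L^T *m L) = 0.
  (* An invertible Gram matrix would have rank [n], yet its rank is at most that of [L]. *)
  apply/eqP/negPn; rewrite -unitfE -unitmxE; apply/negP => /mxrank_unit rkn.
  by have := mxrankM_maxr L^T L; rewrite rkn leqNgt rkL.
have GL := cvg_gram _ _ _ _ AL.
(* The given bound may be nonpositive; [M] is a positive one above it. *)
apply/cvgeyPge => M0; pose M := Num.max M0 1.
have M_gt0 : 0 < M by rewrite lt_max ltr01 orbT.
(* Dividing by [n.+1] instead of [n] makes [b *+ n] strictly smaller than the limit trace, so the
   inequality persists near the limit. *)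
pose b := \tr (L^T *m L) / (n.+1)%:R.
have b0 : 0 < b by rewrite divr_gt0.
have bn : b *+ n < \tr (L^T *m L).
  by rewrite /b -mulr_natr mulrAC ltr_pdivrMr // ltr_pM2l // ltr_nat.
have e0 : \det (L^T *m L) < (b / M ^+ 2) ^+ n.
  by rewrite detL exprn_gt0 // divr_gt0 // exprn_gt0.
near=> x.
apply: (@le_trans _ _ M%:E); first by rewrite lee_fin le_max lexx.
apply: (cond_number_ge _ _ _ _ _ _ M_gt0 b0).
- by near: x; exact: (cvgr_gt _ (cvg_mxtrace _ _ _ GL)).
- by near: x; exact: (cvgr_lt _ (cvg_det _ _ _ GL)).
Unshelve. all: by end_near. Qed.

End entrywise_limits.

Theorem proposition1 (R : realType)
  (d d' : measure_display) (Omega : measurableType d)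
  (Omega' : measurableType d')
  (P : probability Omega R) (Q : probability Omega' R)
  (T x0 : R) (hT : 0 < T) (hx0 : 0 < x0)
  (F : R -> set (set Omega)) (hF : is_filtration T F)
  (m : nat) (hm : (0 < m)%N)
  (W : 'I_m -> R -> Omega -> R) (hW : is_brownian_motion P T F W)
  (mu : R -> Omega -> (R -> R) -> R)
  (sigma : 'I_m -> R -> Omega -> (R -> R) -> R)
  (hmu : progressive_functional T F mu)
  (hsigma : forall i, progressive_functional T F (sigma i))
  (X : R -> Omega -> R)
  (hX : is_unique_strong_solution P T F W mu sigma x0 X)
  (N K : nat) (hN : (0 < N)%N) (hK : (1 < K)%N)
  (Xs : 'I_N -> R -> Omega' -> R)
  (hXs : forall n, is_copy P Q T X (Xs n))
  (hXs0 : forall n, {ae Q, forall w, Xs n 0 w = x0})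
  (f : 'I_K -> R -> R) (hf : forall k, continuous (f k))
  (hfx0 : 0 < \sum_(k < K) f k x0 ^+ 2) :
  {ae Q, forall w,
    cond_number (regression_matrix f Xs t w) @[t --> 0^'+] --> +oo%E}.
Proof.
have Xs_ae n : {ae Q, forall w,
    {within `[0, T], continuous (Xs n ^~ w)} /\ Xs n 0 w = x0}.
  have [_ _ Xs_cont] := hXs n.
  by have := hXs0 n; apply: filterS2 Xs_cont.
(* There are finitely many paths, so almost surely all are good at once. *)
apply: filterS (filter_forall _ Xs_ae) => w Xsw.
pose L : 'M[R]_(N, K) := \matrix_(n, k) f k x0.
apply: (@cvg_cond_number_pinfty _ _ _ _ _ _ _ L) => [n k||].
- rewrite mxE; under eq_fun do rewrite mxE.
  (* Continuity within [[0, T]] contains right-continuity at 0, because [0 < T]. *)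
  have [/(continuous_within_itvP _ hT)[_ Xs_right _] Xs0] := Xsw n.
  by apply: continuous_cvg; [exact: hf | rewrite -Xs0].
- apply: contraTneq hfx0 => L0; rewrite big1 ?ltxx // => k _.
  (* The first row of [L] exists by [hN]; its vanishing would make every [f k x0] zero. *)
  by have /matrixP/(_ (Ordinal hN) k) := L0; rewrite !mxE => ->; rewrite expr0n.
(* A column of ones times a row has rank at most 1, which is below [K]. *)
- suff -> : L = (const_mx 1 : 'cV_N) *m (\row_k f k x0).
    exact: leq_ltn_trans (mulmx_max_rank _ _) hK.
  by apply/matrixP => n k; rewrite !mxE big_ord1 !mxE mul1r.
Qed.
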